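(* Let $X$ be a real Banach space and let $Y$ be a proper $M$-ideal in $X$, i.e. $Y\subsetneq X$ is a closed subspace and $X^*=Z\oplus_1Y^\perp$ for some subspace $Z$ of $X^*$. If $Z$ is $1$-norming for $X$, then both $X$ and $Y$ have the strong diameter 2 property. In particular, if $X$ is a proper $M$-embedded space, then both $X$ and $X^{**}$ have the strong diameter 2 property.
   Context: $Y^\perp\subset X^*$ is the annihilator of $Y$. $X^*=Z\oplus_1Y^\perp$ means that $X^*$ is the algebraic direct sum of $Z$ and $Y^\perp$ and $\|z+y^\perp\|=\|z\|+\|y^\perp\|$ for all $z\in Z$, $y^\perp\in Y^\perp$; $Y$ is then called an $M$-ideal in $X$. $Z$ is $1$-norming for $X$ if $\|x\|=\sup\{|z(x)|: z\in Z,\ \|z\|\le1\}$ for all $x\in X$. $X$ is $M$-embedded if $X$ (canonically embedded) is an $M$-ideal in $X^{**}$, and proper $M$-embedded if in addition $X\ne X^{**}$. For a Banach space $E$ with closed unit ball $B_E$ and dual unit sphere $S_{E^*}$, a slice of $B_E$ is a set $S(x^*,\varepsilon)=\{x\in B_E: x^*(x)>1-\varepsilon\}$ with $x^*\in S_{E^*}$, $\varepsilon>0$. A finite convex combination of slices is a set $\sum_{i=1}^n\lambda_iS(x_i^*,\varepsilon_i)=\{\sum_{i=1}^n\lambda_ix_i: x_i\in S(x_i^*,\varepsilon_i)\}$ with $n\ge1$, $\lambda_i\ge0$, $\sum_{i=1}^n\lambda_i=1$, $x_i^*\in S_{E^*}$, $\varepsilon_i>0$. $E$ has the strong diameter 2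 property if every finite convex combination of slices of $B_E$ has diameter 2. *)

(* Defs.v *)
From HB Require Import structures.
From mathcomp Require Import all_boot all_order all_algebra.
From mathcomp Require Import all_classical all_reals all_analysis.

Set Implicit Arguments.
Unset Strict Implicit.
Unset Printing Implicit Defensive.

Import Order.TTheory GRing.Theory Num.Theory.
Import numFieldNormedType.Exports.

Local Open Scope classical_set_scope.
Local Open Scope ring_scope.

Section dual_space.
Context {R : realType} (E : normedModType R).

Definition dual_pred : {pred E -> R^o} :=
  mem [set f : E -> R^o | linear f /\ continuous f].

Record dual := Dual {
  dual_fun :> E -> R^o ;
  dual_funP : dual_fun \in dual_pred }.

HB.instance Definition _ := [isSub for dual_fun].
HB.instance Definition _ := [Choice of dual by <:].

Lemma dual_pred_submod_closed : submod_closed dual_pred.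
Proof.
split; first by apply/mem_set; split; [move=> a x y /=; rewrite !addr0 scaler0
                                      |exact: cst_continuous].
move=> a f g /set_mem[lf cf] /set_mem[lg cg]; apply/mem_set; split.
  move=> b x y; rewrite !fctE (lf b x y) (lg b x y).
  by rewrite !scalerDr !scalerA (mulrC a b) addrACA.
by move=> x; apply: cvgD; [apply: cvgZl_tmp; exact: cf|exact: cg].
Qed.

HB.instance Definition _ := GRing.isSubmodClosed.Build _ _ dual_pred
  dual_pred_submod_closed.
HB.instance Definition _ := [SubChoice_isSubLmodule of dual by <:].

Lemma dual_linear (f : dual) : linear f.
Proof. by have /set_mem[] := dual_funP f. Qed.

Lemma dual_continuous (f : dual) : continuous f.
Proof. by have /set_mem[] := dual_funP f. Qed.

HB.instance Definition _ (f : dual) :=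
  GRing.isLinear.Build R E R^o *:%R f (dual_linear f).

Lemma dualP (f g : dual) : f =1 g -> f = g.
Proof. by move=> fg; apply/val_inj/funext. Qed.

Lemma dualDE (f g : dual) x : (f + g) x = f x + g x.
Proof. by []. Qed.

Lemma dualZE a (f : dual) x : (a *: f) x = a * f x.
Proof. by []. Qed.

(* For linear f the set below is bounded exactly when f is continuous
   (has_sup_dual_norm), so this real-valued sup never takes its junk value. *)
Definition dual_norm (f : dual) : R :=
  sup [set `|f x| | x in [set x : E | `|x| <= 1]].

Lemma has_sup_dual_norm (f : dual) :
  has_sup [set `|f x| | x in [set x : E | `|x| <= 1]].
Proof.
split; first by exists `|f 0|; exists 0 => //=; rewrite normr0.
have /linear_bounded_continuous/linear_boundedP := @dual_continuous f.
move=> /pinfty_ex_gt0[M M0 fM]; exists M => _ [x /= x1 <-].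
by rewrite (le_trans (fM x))// ler_piMr// ltW.
Qed.

Lemma le_dual_norm (f : dual) x : `|f x| <= dual_norm f * `|x|.
Proof.
have [->|x0] := eqVneq x 0; first by rewrite linear0 !normr0 mulr0.
have nx0 : 0 < `|x| by rewrite normr_gt0.
rewrite -ler_pdivrMr//; apply: (sup_upper_bound (has_sup_dual_norm f)).
exists (`|x|^-1 *: x) => /=.
  by rewrite normrZ normfV normr_id mulVf ?gt_eqF.
by rewrite linearZ normrZ normfV normr_id mulrC.
Qed.

Lemma dual_norm_le (f : dual) M :
  (forall x, `|x| <= 1 -> `|f x| <= M) -> dual_norm f <= M.
Proof.
move=> fM; apply: ge_sup; first by have [] := has_sup_dual_norm f.
by move=> _ [x x1 <-]; exact: fM.
Qed.

Lemma dual_norm_ge0 (f : dual) : 0 <= dual_norm f.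
Proof.
apply: (le_trans (normr_ge0 (f 0))).
apply: (sup_upper_bound (has_sup_dual_norm f)).
by exists 0 => //=; rewrite normr0.
Qed.

Let dual_normD f g : dual_norm (f + g) <= dual_norm f + dual_norm g.
Proof.
apply: dual_norm_le => x x1; rewrite dualDE (le_trans (ler_normD _ _))//.
by apply: lerD; rewrite (le_trans (le_dual_norm _ _))// ler_piMr// dual_norm_ge0.
Qed.

Let dual_normZ_le a f : dual_norm (a *: f) <= `|a| * dual_norm f.
Proof.
apply: dual_norm_le => x x1; rewrite dualZE normrM ler_wpM2l//.
by rewrite (le_trans (le_dual_norm _ _))// ler_piMr// dual_norm_ge0.
Qed.

Let dual_normZ a f : dual_norm (a *: f) = `|a| * dual_norm f.
Proof.
apply/eqP; rewrite eq_le dual_normZ_le/=.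
have [->|a0] := eqVneq a 0; first by rewrite normr0 mul0r dual_norm_ge0.
rewrite -ler_pdivlMl ?normr_gt0// -normfV.
by rewrite -{1}[f](scalerK a0) dual_normZ_le.
Qed.

Let dual_norm0 f : dual_norm f = 0 -> f = 0.
Proof.
move=> f0; apply: dualP => x; apply/eqP; rewrite -normr_le0.
by rewrite (le_trans (le_dual_norm f x))// f0 mul0r.
Qed.

HB.instance Definition _ := Lmodule_isNormed.Build R dual
  dual_normD dual_normZ dual_norm0.

Lemma dual_normE (f : dual) :
  `|f| = sup [set `|f x| | x in [set x : E | `|x| <= 1]].
Proof. by []. Qed.

End dual_space.

Section dual_complete.
Context {R : realType} (E : normedModType R).

Let dual_cauchy_cvg (F : set_system (dual E)) :
  ProperFilter F -> cauchy F -> cvg F.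
Proof.
move=> FF /cauchyP Fc.
have Fx (x : E) : cvg ((fun f : dual E => f x : R^o) @ F).
  apply: cauchy_cvg; apply/cauchyP => e e0.
  have x1 : 0 < `|x| + 1 by rewrite ltr_wpDl.
  have [f Ff] := Fc (e / (`|x| + 1)) (divr_gt0 e0 x1).
  exists (f x) => /=; apply: filterS Ff => h.
  rewrite -!ball_normE /= => fh.
  rewrite (_ : f x - h x = (f - h) x) // (le_lt_trans (le_dual_norm _ _))//.
  rewrite (@le_lt_trans _ _ (e / (`|x| + 1) * `|x|))//.
    by rewrite ler_wpM2r// ltW.
  by rewrite mulrAC ltr_pdivrMr// ltr_pM2l// ltrDl.
pose g (x : E) : R^o := lim ((fun f : dual E => f x : R^o) @ F).
have gE x : (fun f : dual E => f x : R^o) @ F --> g x by exact: Fx.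
have lg : linear g.
  move=> a x y; apply: cvg_lim => //.
  rewrite [X in X @ F](_ : _ = (fun f : dual E => a *: (f x : R^o) + f y)).
    by apply: cvgD; [apply: cvgZl_tmp; exact: gE|exact: gE].
  by apply/funext => f; rewrite linearP.
have near_g (f : dual E) e x : F (ball f e) -> `|f x - g x| <= e * `|x|.
  move=> Ff; apply/ler_addgt0Pr => d d0.
  have /cvgrPdist_lt/(_ d d0) gd := gE x.
  have [h [/= hd]] := filter_ex (filterI gd Ff).
  rewrite -ball_normE /= => fh.
  rewrite -(subrKA (h x)) (le_trans (ler_normD _ _))// lerD//; last first.
    by rewrite distrC ltW.
  rewrite (_ : f x - h x = (f - h) x) // (le_trans (le_dual_norm _ _))//.
  by rewrite ler_wpM2r// ltW.
pose L := GRing.isLinear.Build R E R^o *:%R g lg.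
pose gL : {linear E -> R^o} := HB.pack g L.
have cg : continuous g.
  apply: (@bounded_linear_continuous _ _ _ gL); apply/linear_boundedP.
  have [f Ff] := Fc 1 ltr01.
  near=> r => x /=.
  rewrite (@le_trans _ _ ((dual_norm f + 1) * `|x|))//; last first.
    by rewrite ler_wpM2r//; near: r; apply: nbhs_pinfty_ge; rewrite num_real.
  rewrite mulrDl (_ : g x = f x - (f x - g x)); last by rewrite opprB addrC subrK.
  by rewrite (le_trans (ler_normB _ _))// lerD ?le_dual_norm ?near_g.
have gP : g \in @dual_pred R E by apply/mem_set.
apply/cvg_ex; exists (Dual gP); apply/cvgrPdist_le => e e0.
have e20 : 0 < e / 2 by rewrite divr_gt0.
have [f Ff] := Fc (e / 2) e20.
apply: filterS (Ff) => h; rewrite -ball_normE /= => fh.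
rewrite -(subrKA f) (le_trans (ler_normD _ _))// (splitr e) lerD ?(ltW fh)//.
apply: dual_norm_le => x x1; rewrite [X in `|X|](_ : _ = g x - f x)// distrC.
by rewrite (le_trans (near_g _ _ _ Ff))// ler_piMr// ltW.
Unshelve. all: by end_near. Qed.

HB.instance Definition _ := Uniform_isComplete.Build (dual E) dual_cauchy_cvg.

End dual_complete.

Section subspace_normed.
Context {R : realType} (E : normedModType R) (Y : submodClosed E).

Record subspace_type := Subspace {
  subspace_val :> E ;
  subspace_valP : subspace_val \in Y }.

HB.instance Definition _ := [isSub for subspace_val].
HB.instance Definition _ := [Choice of subspace_type by <:].
HB.instance Definition _ := [SubChoice_isSubLmodule of subspace_type by <:].

Definition subspace_norm (y : subspace_type) : R := `|subspace_val y|.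

Let subspace_normD x y :
  subspace_norm (x + y) <= subspace_norm x + subspace_norm y.
Proof. exact: ler_normD. Qed.

Let subspace_normZ a x : subspace_norm (a *: x) = `|a| * subspace_norm x.
Proof. exact: normrZ. Qed.

Let subspace_norm0 x : subspace_norm x = 0 -> x = 0.
Proof. by move=> /normr0_eq0 x0; exact/val_inj. Qed.

HB.instance Definition _ := Lmodule_isNormed.Build R subspace_type
  subspace_normD subspace_normZ subspace_norm0.

End subspace_normed.

Section M_ideal.
Context {R : realType} (X : normedModType R).

Definition annihilator (Y : {pred X}) : set (dual X) :=
  [set f | forall y, y \in Y -> f y = 0].

Definition l1_direct_sum (A B : set X) : Prop :=
  [/\ forall x, exists a b, [/\ A a, B b & x = a + b],
      A `&` B = [set 0]
    & forall a b, A a -> B b -> `|a + b| = `|a| + `|b| ].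

(* For a subspace Z the set is nonempty (0 is in Z); it is bounded by `|x|. *)
Definition one_norming (Z : set (dual X)) : Prop :=
  forall x, `|x| = sup [set `|z x| | z in [set z | Z z /\ `|z| <= 1]].

End M_ideal.

Definition M_ideal (R : realType) (X : normedModType R) (Y : submodClosed X) :=
  closed [set` Y] /\
  exists Z : submodClosed (dual X), l1_direct_sum [set` Z] (annihilator Y).

Section M_embedded.
Context {R : realType} (X : normedModType R).

Let evalP (x : X) : (fun f : dual X => f x : R^o) \in @dual_pred R (dual X).
Proof.
apply/mem_set; split; first by [].
pose L := GRing.isLinear.Build R (dual X) R^o *:%R
  (fun f : dual X => f x : R^o) (fun _ _ _ => erefl).
pose ev : {linear dual X -> R^o} := HB.pack (fun f : dual X => f x : R^o) L.
apply: (@bounded_linear_continuous _ _ _ ev); apply/linear_boundedP.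
near=> r => f /=.
rewrite (le_trans (le_dual_norm f x))// mulrC; apply: ler_wpM2r.
  exact: dual_norm_ge0.
by near: r; apply: nbhs_pinfty_ge; rewrite num_real.
Unshelve. all: by end_near. Qed.

Definition canonical_embedding (x : X) : dual (dual X) := Dual (evalP x).

Definition canonical_image : {pred dual (dual X)} :=
  mem (range canonical_embedding).

Let canonical_image_submod_closed : submod_closed canonical_image.
Proof.
split; first by apply/mem_set; exists 0 => //; apply/dualP => f; exact: linear0.
move=> a _ _ /set_mem[x _ <-] /set_mem[y _ <-].
by apply/mem_set; exists (a *: x + y) => //; apply/dualP => f; exact: linearP.
Qed.

HB.instance Definition _ := GRing.isSubmodClosed.Build _ _ canonical_image
  canonical_image_submod_closed.

Definition M_embedded : Prop := M_ideal canonical_image.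

Definition proper_M_embedded : Prop :=
  M_embedded /\ [set` canonical_image] <> [set: dual (dual X)].

End M_embedded.

Section strong_diameter_2.
Context {R : realType} (E : normedModType R).

Definition diameter (A : set E) : \bar R :=
  ereal_sup [set `|x.1 - x.2|%:E | x in A `*` A].

Definition slice (f : dual E) (e : R) : set E :=
  [set x | `|x| <= 1 /\ 1 - e < f x].

Definition convex_combination n (lambda : 'I_n -> R) (S : 'I_n -> set E) :
    set E :=
  [set \sum_i lambda i *: x i | x in [set x : 'I_n -> E | forall i, S i (x i)]].

Definition strong_diameter_2 : Prop :=
  forall (n : nat) (lambda : 'I_n -> R) (f : 'I_n -> dual E) (e : 'I_n -> R),
    (1 <= n)%N ->
    (forall i, 0 <= lambda i) -> \sum_i lambda i = 1 ->
    (forall i, `|f i| = 1) -> (forall i, 0 < e i) ->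
    diameter (convex_combination lambda (fun i => slice (f i) (e i))) = 2%:E.

End strong_diameter_2.

(* Main.v *)
(* If the norm-one functionals [f i] on [E] admit [g] in the dual unit ball with
   all [`|f i + g|] and [`|f i - g|] almost 2, then every convex combination of
   slices given by the [f i] has diameter 2. In [X^* = Z (+)_1 Y^perp] any
   norm-one [w] in [Y^perp] satisfies [`|z + w| = `|z - w| = `|z| + 1] for all
   [z] in [Z]; since [Z] is 1-norming, its unit ball is weak* dense in that of
   [X^*], so [w] can be replaced by some [g] in [Z] at the cost of an epsilon.
   This settles [X], and also [Y], because restriction to [Y] is isometric from
   [Z] onto [Y^*]. For an M-embedded [X], uniqueness of the complement puts the
   canonical image of [X^*] inside [Z], so [Z] is 1-norming for [X^**]. *)
From HB Require Import structures.
Require Import Defs.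
From mathcomp Require Import all_boot all_order all_algebra.
From mathcomp Require Import all_classical all_reals all_analysis.
From mathcomp Require Import ring lra.

Set Implicit Arguments.
Unset Strict Implicit.
Unset Printing Implicit Defensive.

Import Order.TTheory GRing.Theory Num.Theory.
Import numFieldNormedType.Exports.

Local Open Scope classical_set_scope.
Local Open Scope ring_scope.

(** * Bounded functionals and the Hahn-Banach theorem *)

Lemma ex_dual (R : realType) (E : normedModType R) (g : E -> R^o) (M : R) :
  linear g -> (forall x, `|g x| <= M * `|x|) -> exists h : dual E, h =1 g.
Proof.
move=> lg gM.
pose L := GRing.isLinear.Build R E R^o *:%R g lg.
pose gL : {linear E -> R^o} := HB.pack g L.
have cg : continuous g.
  apply: (@bounded_linear_continuous _ _ _ gL); apply/linear_boundedP.
  exists M; split=> [|r Mr x /=]; first exact: num_real.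
  by rewrite (le_trans (gM x))// ler_wpM2r// ltW.
have gP : g \in @dual_pred R E by apply/mem_set.
by exists (Dual gP).
Qed.

Section Hahn_Banach.
Context {R : realType} (E : normedModType R).
Implicit Types G : set (E * R).

(** Partial functionals are encoded as sets of pairs: linearity and domination together already
    force such a set to be single-valued. *)
Definition linear_graph G := forall a x y r s,
  G (x, r) -> G (y, s) -> G (a *: x + y, a * r + s).

Definition dominated_graph (M : R) G := forall x r, G (x, r) -> r <= M * `|x|.

(** Any two points lie in [G0] joined with a single member of the chain. [G0] is kept outside the
    family so that the empty chain is covered too, with [set0] standing in for a member. *)
Lemma linear_graph_bigcup (G0 : set (E * R)) (F : set (set (E * R))) :
  linear_graph G0 -> (forall G, F G -> linear_graph (G0 `|` G)) ->
  total_on F subset -> linear_graph (G0 `|` \bigcup_(G in F) G).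
Proof.
move=> lG0 lF totF a x y r s; pose GF G := F G \/ G = set0.
have lGF G : GF G -> linear_graph (G0 `|` G).
  by move=> [/lF//|->]; rewrite setU0.
have mem z : (G0 `|` \bigcup_(G in F) G) z -> exists2 G, GF G & (G0 `|` G) z.
  by case=> [?|[G FG Gz]]; [exists set0; [right|left]|exists G; [left|right]].
move=> /mem[G GG Gx] /mem[H GH Hy].
have [GHs|HGs] : G `<=` H \/ H `<=` G.
  case: GG => [FG|->]; last by left.
  by case: GH => [FH|->]; [exact: totF|right].
- have [|HR] := lGF _ GH a x y r s (setUS GHs Gx) Hy; first by left.
  by case: GH HR => [FH HR|->//]; right; exists H.
- have [|GR] := lGF _ GG a x y r s Gx (setUS HGs Hy); first by left.
  by case: GG GR => [FG GR|->//]; right; exists G.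
Qed.

(* The set [A] of lower bounds imposed on the value at [x0] lies below every
   upper bound by the triangle inequality. *)
Lemma dominated_graph_extend (M : R) G x0 : 0 <= M -> G (0, 0) ->
  linear_graph G -> dominated_graph M G ->
  exists c, forall t x r, G (x, r) -> r + t * c <= M * `|x + t *: x0|.
Proof.
move=> M0 G0 lG dG.
have GZ t x r : G (x, r) -> G (t *: x, t * r).
  by move=> Gx; rewrite -[t *: x]addr0 -[t * r]addr0; exact: lG.
pose A := [set a | exists x r, G (x, r) /\ a = r - M * `|x - x0|].
have Aub y s : G (y, s) -> ubound A (M * `|y + x0| - s).
  move=> Gy _ [x [r [Gx ->]]]; rewrite lerBlDr addrAC lerBrDr.
  have /dG := lG 1 _ _ _ _ Gx Gy; rewrite scale1r mul1r => /le_trans; apply.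
  rewrite -mulrDr ler_wpM2l// addrC.
  by rewrite (_ : y + x = (y + x0) + (x - x0)) ?ler_normD// addrACA subrr addr0.
have A0 : A !=set0 by exists (0 - M * `|0 - x0|), 0, 0.
(* Dividing by [|t|] turns the claim into an upper bound of [A] for [t > 0] and into membership in
   [A] for [t < 0]; for [t = 0] it is domination itself. *)
exists (sup A) => t x r Gx; have [t0|t0|->] := ltgtP t 0; last first.
- by rewrite mul0r scale0r !addr0; exact: dG.
- have /(ge_sup A0) := Aub _ _ (GZ t^-1 _ _ Gx).
  rewrite lerBrDr -(ler_pM2l t0) mulrDr mulrA divff ?gt_eqF// mul1r => h.
  rewrite addrC (le_trans h)// mulrCA -{1}(gtr0_norm t0) -normrZ scalerDr.
  by rewrite scalerA divff ?gt_eqF// scale1r.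
- have nt0 : 0 < - t by rewrite oppr_gt0.
  have : (- t)^-1 * r - M * `|(- t)^-1 *: x - x0| <= sup A.
    apply: ub_le_sup; first by exists (M * `|0 + x0| - 0); exact: Aub.
    by exists ((- t)^-1 *: x), ((- t)^-1 * r); split => //; exact: GZ.
  rewrite lerBlDr -(ler_pM2l nt0) mulrA divff ?gt_eqF// mul1r => h.
  rewrite -lerBrDr (le_trans h)// mulrDr mulNr addrC lerD2r.
  rewrite mulrCA -{1}(gtr0_norm nt0) -normrZ scalerBr.
  by rewrite scalerA divff ?gt_eqF// scale1r scaleNr opprK.
Qed.

(** By the one-step extension, a maximal dominated graph is defined everywhere; domination at [x]
    and at [- x] bounds the absolute value. *)
Theorem hahn_banach_graph (M : R) G0 : 0 <= M -> G0 (0, 0) ->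
  linear_graph G0 -> dominated_graph M G0 ->
  exists g : dual E, `|g| <= M /\ forall x r, G0 (x, r) -> g x = r.
Proof.
move=> M0 G00 lG0 dG0.
pose P := [set G | linear_graph (G0 `|` G) /\ dominated_graph M (G0 `|` G)].
have [F FP totF|H [[lH dH] maxH]] := @Zorn_bigcup _ P.
  split; first by apply: linear_graph_bigcup => // G /FP[].
  move=> x r [/dG0//|[G FG Gx]]; have [_] := FP G FG; apply; by right.
set G := G0 `|` H in lH dH.
have G0G : G (0, 0) by left.
have GZ t x r : G (x, r) -> G (t *: x, t * r).
  by move=> Gx; rewrite -[t *: x]addr0 -[t * r]addr0; exact: lH.
have totG x : exists r, G (x, r).
  have [c cP] := dominated_graph_extend x M0 G0G lH dH.
  pose K := [set z | exists t y r, G (y, r) /\ z = (y + t *: x, r + t * c)].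
  have GK : G `<=` K.
    by move=> [y r] Gy; exists 0, y, r; rewrite scale0r mul0r !addr0.
  have G0K : G0 `|` K = K by apply/setUidPr => z G0z; apply: GK; left.
  have PK : P K.
    rewrite /P /= G0K; split.
      move=> a _ _ _ _ [t [y [r [Gy [-> ->]]]]] [u [z [s [Gz [-> ->]]]]].
      exists (a * t + u), (a *: y + z), (a * r + s); split; first exact: lH.
      by congr pair; [rewrite scalerDr scalerDl scalerA addrACA|ring].
    by move=> _ _ [t [y [r [Gy [-> ->]]]]]; exact: cP.
  (* [K] extends [G] by the line through [x], with value [c] at [x]; maximality of [H] forces
     [H = K]. *)
  have : ~ (H `<` K) by move=> /maxH.
  rewrite properEneq => /not_andP[/negP/negPn/eqP HK|]; last first.
    by case; apply: subset_trans GK; exact: subsetUr.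
  exists c; right; rewrite HK; exists 1, 0, 0; split => //.
  by rewrite scale1r mul1r !add0r.
have [g gG] := choice totG.
have Gfun x r : G (x, r) -> r = g x.
  move=> Gx; apply/eqP; rewrite -subr_eq0 eq_le.
  have /dH := lH (-1) _ _ _ _ (gG x) Gx.
  have /dH := lH (-1) _ _ _ _ Gx (gG x).
  by rewrite !scaleN1r !addNr normr0 mulr0 !mulN1r => ? ?;
    apply/andP; split; lra.
have lg : linear (g : E -> R^o) by move=> a x y; apply/esym/Gfun/lH.
have gM x : `|g x : R^o| <= M * `|x|.
  rewrite ler_norml dH// andbT lerNl.
  by have /dH := GZ (-1) _ _ (gG x); rewrite scaleN1r mulN1r normrN.
have [h hg] := ex_dual lg gM.
exists h; split.
  by apply: dual_norm_le => x x1; rewrite hg (le_trans (gM x))// ler_piMr.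
by move=> x r G0x; rewrite hg; apply/esym/Gfun; left.
Qed.

End Hahn_Banach.

(** * Norms of functionals and isometric embeddings *)

Section dual_norm_facts.
Context {R : realType} (E : normedModType R).
Implicit Types f g : dual E.

Lemma dual_norm_gt f r : r < `|f| -> exists x, `|x| <= 1 /\ r < f x.
Proof.
rewrite -subr_gt0 => rf.
have [_ [x /= x1 <-]] := sup_adherent rf (has_sup_dual_norm f).
rewrite -dual_normE opprB addrC subrK => rx.
have [fx0|fx0] := leP 0 (f x); first by exists x; rewrite -(ger0_norm fx0).
by exists (- x); rewrite normrN linearN -(ltr0_norm fx0).
Qed.

Lemma dual_le_norm f x : `|x| <= 1 -> f x <= `|f|.
Proof.
move=> x1; rewrite (le_trans (ler_norm _))// (le_trans (le_dual_norm f x))//.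
by rewrite ler_piMr// dual_norm_ge0.
Qed.

Lemma le_norm_comp (F : normedModType R) (j : E -> F) (h : dual E)
    (z : dual F) : (forall x, `|j x| = `|x|) -> (forall x, h x = z (j x)) ->
  `|h| <= `|z|.
Proof.
move=> jn hz; apply: dual_norm_le => x x1; rewrite hz.
by rewrite (le_trans (le_dual_norm z _))// jn ler_piMr// dual_norm_ge0.
Qed.

Lemma dual_sumZ (T : finType) (a : T -> R) (x : T -> E) f :
  f (\sum_j a j *: x j) = \sum_j a j * (f (x j) : R) :> R.
Proof. by rewrite linear_sum; apply: eq_bigr => j _; rewrite linearZ. Qed.

End dual_norm_facts.

Lemma dual_comp (R : realType) (E F : normedModType R) (j : E -> F)
    (z : dual F) : linear j -> (forall x, `|j x| = `|x|) ->
  exists h : dual E, forall x, h x = z (j x).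
Proof.
move=> lj jn; apply: (@ex_dual _ _ (fun x => z (j x) : R^o) `|z|) => [a x y|x].
  by rewrite lj linearP.
by rewrite -jn le_dual_norm.
Qed.

(** Hahn-Banach for the graph of [f] transported by [j]. An arbitrary isometry [j] serves both for a
    subspace and for the canonical embedding. *)
Lemma dual_extension (R : realType) (E F : normedModType R) (j : E -> F)
    (f : dual E) : linear j -> (forall x, `|j x| = `|x|) ->
  exists h : dual F, `|h| <= `|f| /\ forall x, h (j x) = f x.
Proof.
move=> lj jn; pose G := [set (j x, f x : R) | x in [set: E]].
have j0 : j 0 = 0 by apply: normr0_eq0; rewrite jn normr0.
have [||||h [hf hG]] := @hahn_banach_graph R F `|f| G => //.
- by exists 0 => //; rewrite j0 linear0.
- move=> a _ _ _ _ [x _ [<- <-]] [y _ [<- <-]].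
  by exists (a *: x + y) => //; rewrite lj linearP.
- move=> _ _ [x _ [<- <-]]; rewrite jn (le_trans (ler_norm _))//.
  exact: le_dual_norm.
by exists h; split=> // x; apply: hG; exists x.
Qed.

Lemma canonical_embedding_linear (R : realType) (X : normedModType R) :
  linear (@canonical_embedding R X).
Proof. by move=> a x y; apply: dualP => f; exact: linearP. Qed.

Lemma canonical_embedding_norm (R : realType) (X : normedModType R) (x : X) :
  `|canonical_embedding x| = `|x|.
Proof.
apply/eqP; rewrite eq_le; apply/andP; split.
  apply: dual_norm_le => f f1; rewrite (le_trans (le_dual_norm f x))//.
  by rewrite ler_piMl.
(* A norming functional for [x], extended from the line through [x]. *)
have [||||h [h1 hx]] :=
    @hahn_banach_graph R X 1 [set (t *: x, t * `|x|) | t in [set: R]] => //.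
- by exists 0 => //; rewrite scale0r mul0r.
- move=> a _ _ _ _ [t _ [<- <-]] [u _ [<- <-]].
  by exists (a * t + u) => //; rewrite scalerDl scalerA mulrDl mulrA.
- by move=> _ _ [t _ [<- <-]]; rewrite mul1r normrZ ler_wpM2r// ler_norm.
rewrite -(hx x `|x|); first exact: (dual_le_norm (canonical_embedding x)).
by exists 1 => //; rewrite scale1r mul1r.
Qed.

(** * Norm-one functionals in the annihilator *)

Section annihilator_facts.
Context {R : realType} (X : normedModType R) (Y : submodClosed X).

Lemma annihilatorN (w : dual X) : annihilator Y w -> annihilator Y (- w).
Proof. by move=> wY y yY; rewrite [LHS](congr1 -%R (wY y yY)) oppr0. Qed.

(** For [x0] at distance at least [d > 0] from [Y], the functional [y + t *: x0 |-> t] is bounded by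
    [d^-1]; it is extended and normalized. *)
Lemma annihilator_neq0 : closed [set` Y] -> [set` Y] <> [set: X] ->
  exists w : dual X, annihilator Y w /\ `|w| = 1.
Proof.
move=> cY nY.
have [x0 x0Y] : exists x0, ~ [set` Y] x0.
  by apply/existsNP => h; apply: nY; apply/seteqP; split.
have [d /= d0 dY] : nbhs_ball x0 (~` [set` Y]).
  by rewrite nbhs_ballE; apply: open_nbhs_nbhs; split; rewrite ?openC.
pose G := [set z | exists t y, y \in Y /\ z = (y + t *: x0, t : R)].
have dG : dominated_graph d^-1 G.
  move=> _ _ [t [y [yY [-> ->]]]].
  rewrite mulrC ler_pdivlMr// -[leLHS]mulrC.
  have [->|t0] := eqVneq t 0; first by rewrite mulr0.
  rewrite (le_trans (y := d * `|t|))//.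
    by rewrite ler_wpM2l ?ler_norm// ltW.
  (* Otherwise [- (t^-1 *: y)], a point of [Y], would be closer than [d] to [x0]. *)
  rewrite leNgt; apply/negP; rewrite -ltr_pdivrMr ?normr_gt0//.
  rewrite mulrC -normfV -normrZ => h.
  apply: (dY (- (t^-1 *: y))); last by rewrite /= -scaleNr rpredZ.
  rewrite -ball_normE /= opprK addrC (_ : _ + x0 = t^-1 *: (y + t *: x0))//.
  by rewrite scalerDr scalerA mulVf// scale1r.
have [||||w [_ wG]] := @hahn_banach_graph R X d^-1 G => //.
- by rewrite invr_ge0 ltW.
- by exists 0, 0; rewrite rpred0 scale0r addr0.
- move=> a _ _ _ _ [t [y [yY [-> ->]]]] [u [z [zY [-> ->]]]].
  exists (a * t + u), (a *: y + z); rewrite rpredD ?rpredZ//; split => //.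
  by congr pair; rewrite scalerDr scalerDl scalerA addrACA.
have w0 : `|w| != 0.
  apply/negP; rewrite normr_eq0 => /eqP w0.
  have : w x0 = 1 by apply: wG; exists 1, 0; rewrite rpred0 scale1r add0r.
  by rewrite w0 => /eqP; rewrite eq_sym oner_eq0.
exists (`|w|^-1 *: w); split; last by rewrite normrZ normfV normr_id mulVf.
move=> y yY; rewrite dualZE (wG y 0) ?mulr0//.
by exists 0, y; rewrite scale0r addr0.
Qed.

End annihilator_facts.

(** * A dual criterion for the strong diameter 2 property *)

Section strong_diameter_2_criterion.
Context {R : realType} (E : normedModType R).

Let convex_combination_norm n (lambda : 'I_n -> R) (f : 'I_n -> dual E) e x :
  (forall i, 0 <= lambda i) -> \sum_i lambda i = 1 ->
  convex_combination lambda (fun i => slice (f i) (e i)) x -> `|x| <= 1.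
Proof.
move=> l0 l1 [u uS <-]; rewrite (le_trans (ler_norm_sum _ _ _))// -l1.
apply: ler_sum => i _; rewrite normrZ ger0_norm// ler_piMr//.
by have [] := uS i.
Qed.

(* A point of the ball at which [f i + g] (resp. [f i - g]) is almost 2 lies in
   the slice of [f i], and [g] is almost 1 (resp. -1) there; so [g] separates
   two points of the convex combination by almost 2. *)
Lemma strong_diameter_2_of_dual :
  (forall n (f : 'I_n -> dual E) d, (forall i, `|f i| = 1) -> 0 < d ->
    exists g : dual E, `|g| <= 1 /\
      forall i, 2 - d <= `|f i + g| /\ 2 - d <= `|f i - g|) ->
  strong_diameter_2 E.
Proof.
move=> H n lambda f e _ l0 l1 f1 e0.
apply/eqP; rewrite eq_le; apply/andP; split.
  apply: ge_ereal_sup => _ [[x y] [/= Sx Sy] <-]; rewrite lee_fin.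
  rewrite (le_trans (ler_normB _ _))// (_ : 2 = 1 + 1)//.
  by apply: lerD; [exact: convex_combination_norm Sx|
                   exact: convex_combination_norm Sy].
apply/lee_addgt0Pr => D D0.
(* Values above [2 - 2 * d] leave each summand above [1 - 2 * d], hence [4 * d <= e i] suffices for
   the slices; the separation by [g] loses at most [4 * d <= D]. *)
pose d := \big[Order.min/D]_i e i / 4.
have m0 : 0 < \big[Order.min/D]_i e i by apply/lt_bigmin.
have d0 : 0 < d by rewrite divr_gt0.
have dD : 4 * d <= D by rewrite mulrC divfK//; exact: bigmin_le_id.
have de i : 4 * d <= e i by rewrite mulrC divfK//; exact: bigmin_le.
have [g [g1 fg]] := H n f d f1 d0.
have xE i : exists x, [/\ `|x| <= 1, 1 - e i < f i x & 1 - 2 * d < g x].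
  have [|x [x1]] := @dual_norm_gt _ _ (f i + g) (2 - 2 * d).
    by have [? _] := fg i; lra.
  have := dual_le_norm (f i) x1; have := dual_le_norm g x1; rewrite f1 dualDE.
  by move: (de i) => *; exists x; split => //; lra.
have [x xP] := choice xE.
have yE i : exists x, [/\ `|x| <= 1, 1 - e i < f i x & g x < - (1 - 2 * d)].
  have [|u [u1]] := @dual_norm_gt _ _ (f i - g) (2 - 2 * d).
    by have [_ ?] := fg i; lra.
  have := dual_le_norm (f i) u1.
  have := dual_le_norm (- g) u1; rewrite normrN f1 dualDE.
  rewrite (_ : (- g) u = - g u)//.
  by move: (de i) => *; exists u; split => //; lra.
have [y yP] := choice yE.
pose sx := \sum_i lambda i *: x i; pose sy := \sum_i lambda i *: y i.
rewrite (@le_trans _ _ (`|sx - sy|%:E + D%:E)%E)//; last first.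
  rewrite leeD2r//; apply: ereal_sup_ubound; exists (sx, sy) => //=; split.
    by exists x => // i; have [] := xP i.
  by exists y => // i; have [] := yP i.
rewrite -EFinD lee_fin.
have : g (sx - sy) <= `|sx - sy|.
  rewrite (le_trans (ler_norm _))// (le_trans (le_dual_norm g _))//.
  by rewrite ler_piMl.
have -> : g (sx - sy) = \sum_i lambda i * (g (x i) - g (y i)).
  rewrite /sx /sy -sumrB linear_sum; apply: eq_bigr => i _.
  by rewrite -scalerBr linearZ linearB.
suff : (2 - 4 * d) <= \sum_i lambda i * (g (x i) - g (y i)) by lra.
rewrite -[leLHS]mul1r -[X in X * _ <= _]l1 mulr_suml; apply: ler_sum => i _.
by rewrite ler_wpM2l//; have [_ _ ?] := xP i; have [_ _ ?] := yP i; lra.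
Qed.

End strong_diameter_2_criterion.

(** * Weak-star density of the ball of a 1-norming subspace *)

Section one_norming_dense.
Context {R : realType} (X : normedModType R) (Z : submodClosed (dual X)).
Hypothesis Znorm : one_norming [set` Z].

Lemma one_norming_le (x : X) M :
  (forall z : dual X, z \in Z -> `|z| <= 1 -> z x <= M) -> `|x| <= M.
Proof.
move=> zM; rewrite Znorm; apply: ge_sup.
  by exists `|(0 : dual X) x|, 0 => //=; rewrite rpred0 normr0.
move=> _ [z [/= zZ z1] <-]; rewrite ler_norml zM// andbT lerNl.
rewrite -[leLHS]/((- z) x) zM ?normrN//.
by rewrite -scaleN1r rpredZ.
Qed.

(* Weak* density of the unit ball of [Z] in that of the dual: if [w] cannot be
   matched on the points [x j], let [z] almost minimize the sum of squares and
   put [a j = w (x j) - z (x j)]. As for an exact projection, [z] almost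
   maximizes [z' (\sum_j a j *: x j)], so [w] exceeds the norm of that vector. *)
Lemma one_norming_dense (T : finType) (x : T -> X) (w : dual X) e :
  `|w| <= 1 -> 0 < e -> exists z : dual X,
    [/\ z \in Z, `|z| <= 1 & forall j, `|z (x j) - w (x j)| < e].
Proof.
move=> w1 e0.
pose q (z : dual X) := \sum_j ((w (x j) : R) - z (x j)) ^+ 2.
have q0 z : 0 <= q z by apply: sumr_ge0 => j _; exact: sqr_ge0.
have [[z [zZ z1 qz]]|nqz] :=
    pselect (exists z, [/\ z \in Z, `|z| <= 1 & q z < e ^+ 2]).
  exists z; split=> // j; rewrite -ltr_sqr ?nnegrE ?normr_ge0 ?ltW//.
  rewrite real_normK ?num_real// (le_lt_trans _ qz)// -sqrrN opprB.
  rewrite /q (bigD1 j)//= lerDl.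
  by apply: sumr_ge0 => i _; exact: sqr_ge0.
exfalso.
have e2q z : z \in Z -> `|z| <= 1 -> e ^+ 2 <= q z.
  by move=> zZ z1; rewrite leNgt; apply/negP => qz; apply: nqz; exists z.
pose B := [set q z | z in [set z | z \in Z /\ `|z| <= 1]].
have B0 : B !=set0 by exists (q 0), 0 => //=; rewrite rpred0 normr0.
have lbB : has_lbound B by exists 0 => _ [z _ <-].
have d0 : 0 < inf B.
  rewrite (lt_le_trans (exprn_gt0 2 e0))//.
  by apply: lb_le_inf => // _ [z [zZ z1] <-]; exact: e2q.
(* [D] bounds the sum of squares of [z' (x j) - z (x j)] for [z], [z'] in the unit ball; the step
   length [t] makes [t * (1 + D)] at most [inf B]. *)
pose D := \sum_j 4 * `|x j| ^+ 2 : R.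
have D0 : 0 <= D by apply: sumr_ge0 => j _; rewrite mulr_ge0// sqr_ge0.
pose t := Order.min 1 (inf B / (1 + D)).
have D1 : 0 < 1 + D by rewrite ltr_pwDl.
have t0 : 0 < t by rewrite lt_min ltr01 divr_gt0.
have t1 : t <= 1 by rewrite ge_min lexx.
have tD : t * (1 + D) <= inf B by rewrite -ler_pdivlMr// ge_min lexx orbT.
have [_ [z [zZ z1] <-] qz] := inf_adherent (exprn_gt0 2 t0) (conj B0 lbB).
pose a j := (w (x j) : R) - z (x j).
pose v := \sum_j a j *: x j.
have wv : w v = z v + q z.
  rewrite !dual_sumZ /q -big_split/=; apply: eq_bigr => j _.
  by rewrite /a; ring.
suff : `|v| <= z v + t * (1 + D) / 2.
  have := dual_le_norm.
  have : w v <= `|v|.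
    rewrite (le_trans (ler_norm _))// (le_trans (le_dual_norm w v))//.
    by rewrite ler_piMl.
  have : inf B <= q z by apply: ge_inf => //; exists z.
  by rewrite wv => *; lra.
apply: one_norming_le => z' z'Z z'1.
pose b j := (z' (x j) : R) - z (x j).
(* Moving from [z] towards [z'] stays in the ball of [Z], so [q] cannot drop by more than [t ^+ 2];
   expanding [q] bounds [z' v - z v]. *)
have qt : inf B <= q (z + t *: (z' - z)).
  apply: ge_inf => //; exists (z + t *: (z' - z)) => //; split.
    by rewrite rpredD// rpredZ// rpredD// -scaleN1r rpredZ.
  rewrite (_ : _ + _ = (1 - t) *: z + t *: z'); last first.
    by rewrite scalerBr scalerBl scale1r addrA addrAC.
  rewrite (le_trans (ler_normD _ _))// !normrZ !ger0_norm ?subr_ge0 ?(ltW t0)//.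
    rewrite (@le_trans _ _ ((1 - t) * 1 + t * 1))//; last by lra.
  by rewrite lerD// ler_wpM2l// ?subr_ge0// ltW.
have qtE : q (z + t *: (z' - z)) =
    q z - 2 * t * (\sum_j a j * b j) + t ^+ 2 * \sum_j b j ^+ 2.
  rewrite /q !mulr_sumr -sumrB -big_split/=; apply: eq_bigr => j _.
  rewrite -[LHS]/(((w (x j) : R) - ((z (x j) : R) + t * b j)) ^+ 2) /a; ring.
have bD : \sum_j b j ^+ 2 <= D.
  apply: ler_sum => j _.
  have bj : `|b j| <= 2 * `|x j|.
    rewrite (le_trans (ler_normB _ _))// mulr_natl mulr2n lerD//.
      by rewrite (le_trans (le_dual_norm _ _))// ler_piMl.
    by rewrite (le_trans (le_dual_norm _ _))// ler_piMl.
  rewrite -real_normK ?num_real// (_ : 4 * _ = (2 * `|x j|) ^+ 2); last by ring.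
  by rewrite ler_sqr ?nnegrE ?mulr_ge0.
have abE : \sum_j a j * b j = z' v - z v.
  rewrite !dual_sumZ -sumrB/=; apply: eq_bigr => j _.
  by rewrite /b; ring.
have t2 : t ^+ 2 * \sum_j b j ^+ 2 <= t ^+ 2 * D by rewrite ler_wpM2l ?sqr_ge0.
suff : 2 * (z' v - z v) <= t * (1 + D) by move=> *; lra.
rewrite -(ler_pM2l t0) -abE; lra.
Qed.

End one_norming_dense.

(** * The property for the ambient space and for the M-ideal *)

Section M_ideal_strong_diameter_2.
Context {R : realType} (X : normedModType R).
Variables (Y : submodClosed X) (Z : submodClosed (dual X)).
Hypothesis cY : closed [set` Y].
Hypothesis nY : [set` Y] <> [set: X].
Hypothesis ZY : l1_direct_sum [set` Z] (annihilator Y).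
Hypothesis Znorm : one_norming [set` Z].

(* A norm-one [w] in the annihilator satisfies [`|z i + w| = `|z i| + 1]; the
   witness [g] approximates [w] weak* inside the unit ball of [Z]. *)
Lemma l1_summand_octahedral n (z : 'I_n -> dual X) d :
  (forall i, z i \in Z) -> 0 < d ->
  exists g : dual X, [/\ g \in Z, `|g| <= 1 &
    forall i, `|z i| + 1 - d <= `|z i + g| /\ `|z i| + 1 - d <= `|z i - g|].
Proof.
move=> zZ d0; have [w [wY w1]] := annihilator_neq0 cY nY.
have [_ _ nZY] := ZY.
have xE (i : 'I_n) : exists x, `|x| <= 1 /\ `|z i| + 1 - d / 2 < (z i + w) x.
  apply: dual_norm_gt; rewrite (nZY _ _ (zZ i) wY) w1; lra.
have yE (i : 'I_n) : exists x, `|x| <= 1 /\ `|z i| + 1 - d / 2 < (z i - w) x.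
  apply: dual_norm_gt.
  by rewrite (nZY _ _ (zZ i) (annihilatorN wY)) normrN w1; lra.
have [x xP] := choice xE; have [y yP] := choice yE.
(* Both families of points are approximated at once, so that one [g] serves both signs. *)
pose u (s : 'I_n + 'I_n) := match s with inl i => x i | inr i => y i end.
have [||g [gZ g1 gw]] := one_norming_dense Znorm u (w := w) (e := d / 2).
- by rewrite w1.
- by rewrite divr_gt0.
exists g; split => // i; split.
  have [x1] := xP i; have := dual_le_norm (z i + g) x1.
  have : `|g (x i) - w (x i)| < d / 2 := gw (inl i).
  rewrite ltr_norml => /andP[].
  by rewrite !dualDE => *; lra.
have [y1] := yP i; have := dual_le_norm (z i - g) y1.
have : `|g (y i) - w (y i)| < d / 2 := gw (inr i).
rewrite ltr_norml => /andP[].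
rewrite !dualDE (_ : (- g) _ = - g (y i))// (_ : (- w) _ = - w (y i))//.
by move=> *; lra.
Qed.

(** Adding an element of [Z] changes only the [Z]-component of [f i]; the norm of the annihilator
    component [b] makes up for [|z i|] being less than 1. *)
Lemma M_ideal_strong_diameter_2 : strong_diameter_2 X.
Proof.
apply: strong_diameter_2_of_dual => n f d f1 d0.
have [decZY _ nZY] := ZY.
have [z zP] := choice (fun i => decZY (f i)).
have zZ i : z i \in Z by have [b []] := zP i.
have [g [gZ g1 zg]] := l1_summand_octahedral zZ d0.
exists g; split => // i; have [b [_ bY fE]] := zP i; have [zgD zgB] := zg i.
have fb : 1 = `|z i| + `|b| by rewrite -(f1 i) fE (nZY _ _ (zZ i) bY).
have Zadd (h : dual X) : h \in Z -> `|f i + h| = `|z i + h| + `|b|.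
  by move=> hZ; rewrite fE addrAC (nZY _ _ (rpredD (zZ i) hZ) bY).
rewrite !Zadd//; last by rewrite -scaleN1r rpredZ.
by split; lra.
Qed.

(* Every functional extending [h] differs from [z] by an element of the
   annihilator, so has norm at least [`|z|]. *)
Lemma norm_restriction (E : normedModType R) (j : E -> X) (z : dual X)
    (h : dual E) : linear j -> (forall x, `|j x| = `|x|) ->
  [set` Y] = range j -> z \in Z -> (forall x, h x = z (j x)) -> `|z| <= `|h|.
Proof.
move=> lj jn jY zZ hz; have [k [kh kE]] := dual_extension h lj jn.
have [_ _ nZY] := ZY.
have kY : annihilator Y (k - z).
  move=> y yY; have [x _ <-] : range j y by rewrite -jY.
  by rewrite dualDE kE hz subrr.
by rewrite (le_trans _ kh)// -(subrK z k) addrC nZY// lerDl.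
Qed.

(** Each [f i] is extended to the ambient space and its annihilator part dropped, giving [z i] in
    [Z]; [norm_restriction] brings the norms of [z i + g] and [z i - g] back to [E]. *)
Lemma M_ideal_strong_diameter_2_sub (E : normedModType R) (j : E -> X) :
  linear j -> (forall x, `|j x| = `|x|) -> [set` Y] = range j ->
  strong_diameter_2 E.
Proof.
move=> lj jn jY; apply: strong_diameter_2_of_dual => n f d f1 d0.
have [decZY _ nZY] := ZY.
have rangeY : range j `<=` [set` Y] by rewrite jY.
have zE i : exists z : dual X, z \in Z /\ forall x, f i x = z (j x).
  have [k [_ kf]] := dual_extension (f i) lj jn.
  have [z [b [zZ bY kE]]] := decZY k; exists z; split => // x.
  have bj : b (j x) = 0 by apply: bY; apply: (rangeY (j x)); exists x.
  by rewrite -kf kE dualDE bj addr0.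
have [z zP] := choice zE.
have zZ i : z i \in Z by have [] := zP i.
have [g [gZ g1 zg]] := l1_summand_octahedral zZ d0.
have [h hg] := dual_comp g lj jn.
exists h; split; first exact: le_trans (le_norm_comp jn hg) g1.
move=> i; have [zgD zgB] := zg i; have [_ fz] := zP i.
have z1 : 1 <= `|z i| by rewrite -(f1 i) (le_norm_comp jn).
split.
  apply: (@le_trans _ _ `|z i + g|); first lra.
  apply: (norm_restriction lj jn jY) => [|x]; first by rewrite rpredD.
  by rewrite !dualDE fz hg.
apply: (@le_trans _ _ `|z i - g|); first lra.
apply: (norm_restriction lj jn jY) => [|x].
  by rewrite rpredD// -scaleN1r rpredZ.
by rewrite -[LHS]/(f i x - h x) -[RHS]/(z i (j x) - g (j x)) fz hg.
Qed.

End M_ideal_strong_diameter_2.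

(* The functional [J f] on the bidual attains its norm on the image of [X], so
   its component in the annihilator vanishes. *)
Lemma M_embedded_one_norming (R : realType) (X : normedModType R)
    (Z : submodClosed (dual (dual (dual X)))) :
  l1_direct_sum [set` Z] (annihilator (@canonical_image R X)) ->
  one_norming [set` Z].
Proof.
move=> [dec _ nZ].
have JZ (f : dual X) : canonical_embedding f \in Z.
  have [z [b [/= zZ bY fE]]] := dec (canonical_embedding f).
  suff b0 : `|b| = 0 by rewrite fE (normr0_eq0 b0) addr0.
  have fz : `|f| <= `|z|.
    apply: dual_norm_le => x x1.
    rewrite (_ : f x = z (canonical_embedding x)); last first.
      have bx : b (canonical_embedding x) = 0.
        by apply: bY; apply/mem_set; exists x.
      rewrite -[LHS]/(canonical_embedding f (canonical_embedding x)).
      by rewrite fE dualDE bx addr0.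
    rewrite (le_trans (le_dual_norm z _))// canonical_embedding_norm.
    by rewrite ler_piMr// dual_norm_ge0.
  have := canonical_embedding_norm f; rewrite fE nZ// => zb.
  by apply/eqP; rewrite eq_le normr_ge0 andbT; lra.
move=> F; apply/eqP; rewrite eq_le; apply/andP; split.
  (* Each value [F f] is also the value at [F] of [canonical_embedding f], an element of [Z]. *)
  apply: dual_norm_le => f f1; apply: ub_le_sup.
    exists `|F| => _ [z [_ z1] <-].
    by rewrite (le_trans (le_dual_norm z F))// ler_piMl.
  exists (canonical_embedding f) => //.
  by split; [exact: JZ|rewrite (canonical_embedding_norm f)].
apply: ge_sup.
  exists `|(0 : dual (dual (dual X))) F|, 0 => //=.
  by split; [exact: rpred0|rewrite normr0].
by move=> _ [z [_ z1] <-]; rewrite (le_trans (le_dual_norm z F))// ler_piMl.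
Qed.

Theorem theorem4p10 (R : realType) (X : completeNormedModType R) :
  (forall (Y : submodClosed X) (Z : submodClosed (dual X)),
      closed [set` Y] ->
      [set` Y] <> [set: X] ->
      l1_direct_sum [set` Z] (annihilator Y) ->
      one_norming [set` Z] ->
      strong_diameter_2 X /\ strong_diameter_2 (subspace_type Y))
  /\
  (proper_M_embedded X ->
      strong_diameter_2 X /\ strong_diameter_2 (dual (dual X))).
Proof.
split=> [Y Z cY nY ZY Znorm|[[cX [Z ZX]] nX]].
  split; first exact: M_ideal_strong_diameter_2 cY nY ZY Znorm.
  apply: (M_ideal_strong_diameter_2_sub cY nY ZY Znorm
            (j := @subspace_val R X Y)) => //.
  apply/seteqP; split=> [y yY|_ [y _ <-]]; last exact: subspace_valP.
  by exists (Subspace yY).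
(* The bidual is now the ambient space, and [X] is an isometric copy of the M-ideal. *)
have Znorm := M_embedded_one_norming ZX.
split; last exact: M_ideal_strong_diameter_2 cX nX ZX Znorm.
apply: (M_ideal_strong_diameter_2_sub cX nX ZX Znorm
          (j := @canonical_embedding R X)).
- exact: canonical_embedding_linear.
- exact: canonical_embedding_norm.
- by apply/seteqP; split=> x /=; [move/set_mem|move=> ?; apply/mem_set].
Qed.
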